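(* There exists a closed-valued separately continuous mapping $f:[0,1]^2\to\mathbb R$ whose diagonal $x\mapsto f(x,x)$, $x\in[0,1]$, is everywhere discontinuous, i.e. is not continuous at any point of $[0,1]$.
   Context: A closed-valued mapping $f:X\to Y$ assigns to each $x\in X$ a nonempty closed subset $f(x)\subseteq Y$; it is regarded as a mapping into the space $\mathcal F(Y)$ of all nonempty closed subsets of $Y$ with the Vietoris topology. Such a (multi-valued) mapping is upper continuous at $x_0\in X$ if for every open $V\subseteq Y$ with $f(x_0)\subseteq V$ there is a neighborhood $U$ of $x_0$ with $f(x)\subseteq V$ for all $x\in U$; it is lower continuous at $x_0$ if for every open $V\subseteq Y$ with $f(x_0)\cap V\neq\emptyset$ there is a neighborhood $U$ of $x_0$ with $f(x)\cap V\neq\emptyset$ for all $x\in U$; it is continuous at $x_0$ if it is both upper and lower continuous at $x_0$. A mapping on $[0,1]^2$ is separately continuous if it is continuous (in this sense) with respect to each variable when the other one is fixed. *)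

(* Defs.v *)
From mathcomp Require Import all_boot all_order all_algebra.
From mathcomp Require Import all_classical all_reals all_analysis.
Import Order.TTheory GRing.Theory Num.Theory.
Import numFieldNormedType.Exports.

Set Implicit Arguments.
Unset Strict Implicit.
Unset Printing Implicit Defensive.

Local Open Scope classical_set_scope.
Local Open Scope ring_scope.

(* A multi-valued mapping from X to Y is a function X -> set Y. *)

Definition closed_valued (X : Type) (Y : topologicalType) (f : X -> set Y) :
    Prop :=
  forall x, f x !=set0 /\ closed (f x).

Definition upper_continuous_at (X Y : topologicalType) (f : X -> set Y)
    (x0 : X) : Prop :=
  forall V : set Y, open V -> f x0 `<=` V -> \forall x \near x0, f x `<=` V.

Definition lower_continuous_at (X Y : topologicalType) (f : X -> set Y)
    (x0 : X) : Prop :=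
  forall V : set Y, open V -> f x0 `&` V !=set0 ->
    \forall x \near x0, f x `&` V !=set0.

(* For closed-valued f this is continuity at x0 for the Vietoris topology on
   the space of nonempty closed subsets of Y. *)
Definition mv_continuous_at (X Y : topologicalType) (f : X -> set Y)
    (x0 : X) : Prop :=
  upper_continuous_at f x0 /\ lower_continuous_at f x0.

Definition mv_separately_continuous (X1 X2 Y : topologicalType)
    (f : X1 * X2 -> set Y) : Prop :=
  (forall (y : X2) (x0 : X1), mv_continuous_at (fun x : X1 => f (x, y)) x0) /\
  (forall (x : X1) (y0 : X2), mv_continuous_at (fun y : X2 => f (x, y)) y0).

(* [0, 1] as a type of its own: [set_type] carries the topology induced by the
   inclusion into R, so neighbourhoods of a point are relative to [0, 1]. *)
Definition unit_itv (R : realType) : topologicalType :=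
  set_type (`[0, 1]%classic : set R).

(* Main.v *)
(** Take f(x, y) to be the union over n of the intervals
    [[n, n + min (u_n x) (u_n y) * max 0 (1 - n |x - y|)]], where u_n x is x / 2
    for odd n and (1 - x) / 2 for even n. Each interval depends continuously on
    (x, y). Away from the diagonal almost all of them are locally reduced to
    {n}, and an interval at (x, y) is never longer than those at (x, x) and
    (y, y), so f is upper continuous in each variable. Along the diagonal, moving
    x to either side lengthens infinitely many intervals by a fixed amount, which
    contradicts upper continuity for an open set whose margin around the n-th
    interval tends to 0. *)

Require Import Defs.
From mathcomp Require Import all_boot all_order all_algebra.
From mathcomp Require Import all_classical all_reals all_analysis.
From mathcomp Require Import lra.
Import Order.TTheory GRing.Theory Num.Theory.
Import numFieldNormedType.Exports.

Local Open Scope classical_set_scope.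
Local Open Scope ring_scope.

(** * Unions of teeth based at the naturals *)

Definition comb {R : realType} (g : nat -> R) : set R :=
  \bigcup_n [set n%:R + s * g n | s in `[0, 1]].

Lemma tooth_closed {R : realType} (a b : R) :
  closed [set a + s * b | s in `[0, 1]].
Proof.
apply: compact_closed; first exact: norm_hausdorff.
apply: continuous_compact; last exact: segment_compact.
apply: continuous_subspaceT => s.
by apply: cvgD; [exact: cvg_cst|apply: cvgM; [exact: cvg_id|exact: cvg_cst]].
Qed.

Lemma comb_neq0 {R : realType} (g : nat -> R) : comb g !=set0.
Proof.
exists (0%:R + 0 * g 0%N), 0%N => //; exists 0 => //=.
by rewrite in_itv/= lexx ler01.
Qed.

(** The teeth are locally finite: the tooth at [n] lies to the right of [n], so only teeth with
    [n < N] can meet the unit ball around [t], and a finite union of closed teeth is closed. *)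
Lemma comb_closed {R : realType} (g : nat -> R) :
  (forall n, 0 <= g n) -> closed (comb g).
Proof.
move=> g0 t tcl.
pose N := (Num.truncn (`|t| + 1)).+1.
pose G := \bigcup_(n in `I_N) [set n%:R + s * g n | s in `[0, 1]].
have Gcl : closed G.
  by apply: closed_bigcup; [exact: finite_II|move=> n _; exact: tooth_closed].
suff : closure G t by move=> /Gcl [n _ ?]; exists n.
move=> B Bt.
have : nbhs t (B `&` ball t 1) by apply: filterI => //; exact: nbhsx_ballx.
move=> /tcl[z [[n _ [s /= s01 <-]] [Bz tz]]].
exists (n%:R + s * g n); split => //; exists n => //=; last by exists s.
move: s01; rewrite in_itv/= => /andP[s0 s1].
have sg : 0 <= s * g n by rewrite mulr_ge0.
rewrite -(ltr_nat R).
apply: le_lt_trans (truncnS_gt _).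
move: tz; rewrite /ball/= ltr_norml => /andP[t1 t2].
have := ler_norm t; lra.
Qed.

(* Upper continuity of an unbounded set cannot control infinitely many teeth
   at once; it survives because the far teeth do not outgrow those at [x0]. *)
Lemma comb_continuous {R : realType} (X : topologicalType)
    (g : X -> nat -> R) (x0 : X) (N : nat) :
  (forall n, {for x0, continuous (g ^~ n)}) ->
  (forall x n, 0 <= g x n) ->
  (\forall x \near x0, forall n, (N <= n)%N -> g x n <= g x0 n) ->
  mv_continuous_at (fun x => comb (g x)) x0.
Proof.
move=> gc g0 gN; split=> V Vop.
- move=> fV.
  have near_tooth n : \forall x \near x0,
      [set n%:R + s * g x n | s in `[0, 1]] `<=` V.
    (* Tube lemma: compactness in the parameter [s] yields one neighbourhood of [x0] valid for the
       whole tooth. *)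
    have : compact (`[0, 1] : set R) by exact: segment_compact.
    move=> /compact_near_coveringP/(_ X (nbhs x0)
      (fun x s => V (n%:R + s * g x n)) _) cov.
    have : \forall x \near x0,
        `[0, 1]%classic `<=` (fun s => V (n%:R + s * g x n)).
      apply: cov => s s01.
      have Vs : nbhs (n%:R + s * g x0 n) V.
        by apply: open_nbhs_nbhs; split => //; apply: fV; exists n => //; exists s.
      have : (n%:R + p.1 * g p.2 n) @[p --> (s, x0)] --> n%:R + s * g x0 n.
        apply: cvgD; first exact: cvg_cst.
        apply: cvgM; first exact: cvg_fst.
        apply: (cvg_comp snd (g ^~ n)); last exact: gc.
        exact: cvg_snd.
      by move=> /(_ _ Vs).
    by apply: filterS => x xV _ [s s01 <-]; exact: xV.
  have near_teeth : \forall x \near x0, forall n : 'I_N,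
      [set n%:R + s * g x n | s in `[0, 1]] `<=` V.
    by apply: filter_forall => n; exact: near_tooth.
  apply: filterS2 near_teeth gN => x xV xN _ [n _ [s s01 <-]].
  have [nN|Nn] := ltnP n N.
    by apply: (xV (Ordinal nN)); exists s.
  apply: fV; exists n => //.
  (* The far tooth at [x] is contained in the one at [x0]: rescale the parameter, unless
     [g x0 n = 0], when both teeth are [{n}]. *)
  have := xN n Nn; have := g0 x n; have := g0 x0 n.
  move: s01 => /=; rewrite in_itv/= => /andP[s0 s1].
  rewrite le_eqVlt => /predU1P[<- ga gb|gp ga gb].
    have -> : g x n = 0 by apply/eqP; rewrite eq_le ga gb.
    by exists s; rewrite //= in_itv/= s0 s1.
  exists (s * g x n / g x0 n); last by rewrite divfK// gt_eqF.
  rewrite /= in_itv/= divr_ge0 ?mulr_ge0 ?(ltW gp)//= ler_pdivrMr// mul1r.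
  by rewrite (le_trans _ gb)// ler_piMl.
- move=> [_ [[n _ [s s01 <-]] Vs]].
  have Vn : nbhs (n%:R + s * g x0 n) V by exact: open_nbhs_nbhs.
  have cvg_tooth : (n%:R + s * g x n) @[x --> x0] --> n%:R + s * g x0 n.
    apply: cvgD; first exact: cvg_cst.
    by apply: cvgM; [exact: cvg_cst|exact: gc].
  have : \forall x \near x0, V (n%:R + s * g x n) by exact: cvg_tooth _ Vn.
  apply: filterS => x xV.
  by exists (n%:R + s * g x n); split => //; exists n => //; exists s.
Qed.

(* The open set witnessing this surrounds the [n]-th tooth by a margin
   tending to 0. *)
Lemma comb_upper {R : realType} (X : topologicalType)
    (g : X -> nat -> R) (x0 : X) :
  (forall x n, 0 <= g x n <= 1 / 2) ->
  upper_continuous_at (fun x => comb (g x)) x0 ->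
  \forall x \near x0, forall n, g x n < g x0 n + n.+1%:R^-1 / 4.
Proof.
move=> g01 uc.
pose e n : R := n.+1%:R^-1 / 4.
have e0 n : 0 < e n by rewrite divr_gt0// invr_gt0.
have e1 n : e n <= 1 / 4.
  by rewrite ler_pM2r ?invr_gt0// invf_le1 ?ler1n.
(* As [g x0 n <= 1 / 2] and [e n <= 1 / 4], the [n]-th interval ends by [n + 3 / 4], where the next
   one starts; hence they are disjoint. *)
pose V : set R := \bigcup_n `]n%:R - 1 / 4, n%:R + g x0 n + e n[%classic.
have Vop : open V by apply: bigcup_open => n _; exact: interval_open.
have : comb (g x0) `<=` V.
  move=> _ [n _ [s /= + <-]]; rewrite in_itv/= => /andP[s0 s1].
  exists n => //=; rewrite in_itv/=.
  have /andP[g0 g1] := g01 x0 n; have := e0 n.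
  have : 0 <= s * g x0 n by rewrite mulr_ge0.
  have : s * g x0 n <= g x0 n by rewrite ler_piMl.
  lra.
move=> /(uc _ Vop); apply: filterS => x xV n.
(* The tip of the [n]-th tooth lies in [V], and by the spacing only in the [n]-th interval. *)
have [|m _ /=] := xV (n%:R + 1 * g x n).
  by exists n => //; exists 1 => //=; rewrite in_itv/= lexx ler01.
rewrite in_itv/= mul1r => /andP[].
have /andP[gn0 gn1] := g01 x n; have /andP[gm0 gm1] := g01 x0 m.
have := e1 m.
have [nm|mn|->] := ltngtP n m; last by rewrite -/(e m); lra.
- by move: nm; rewrite -(ler_nat R) -natr1; lra.
- by move: mn; rewrite -(ler_nat R) -natr1; lra.
Qed.

(** * Lengths of the teeth *)

Definition slope {R : realType} (n : nat) (x : R) : R :=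
  (if odd n then x else 1 - x) / 2.

(** The second factor is a cutoff, equal to 1 on the diagonal and to 0 once [n%:R * |x - y|] reaches
    1; the minimum keeps the length below both diagonal values. *)
Definition height {R : realType} (x y : R) (n : nat) : R :=
  Num.min (slope n x) (slope n y) * Num.max 0 (1 - n%:R * `|x - y|).

Lemma heightC {R : realType} (x y : R) : height x y = height y x.
Proof. by apply/funext => n; rewrite /height minC distrC. Qed.

Lemma heightxx {R : realType} (x : R) n : height x x n = slope n x.
Proof.
by rewrite /height minxx subrr normr0 mulr0 subr0 (max_idPr _) ?mulr1.
Qed.

Lemma slope_itv {R : realType} (x : R) n :
  0 <= x <= 1 -> 0 <= slope n x <= 1 / 2.
Proof. by move=> /andP[x0 x1]; rewrite /slope; case: odd; lra. Qed.

(* Only one parity of [n] works, according to the sign of [x - y]. *)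
Lemma slope_gap {R : realType} (x y : R) :
  x != y -> exists n, slope n y + n.+1%:R^-1 / 4 <= slope n x.
Proof.
move=> xy; pose d := `|x - y|; pose m := Num.truncn d^-1.
have d0 : 0 < d by rewrite normr_gt0 subr_eq0.
(* From [m] on, the margin is below [d / 4], while [slope n] changes by [d / 2] between [x] and
   [y]. *)
have small n : (m <= n)%N -> n.+1%:R^-1 < d.
  move=> mn; rewrite invf_plt ?posrE//.
  by rewrite (lt_le_trans (truncnS_gt _))// ler_nat ltnS.
have mm : (m <= m.*2)%N by rewrite -addnn leq_addr.
move: xy d0; rewrite neq_lt => /orP[xy|yx] d0.
- exists m.*2; have := small _ mm.
  by rewrite /slope odd_double /d distrC gtr0_norm ?subr_gt0//; move: _^-1 => e; lra.
- exists m.*2.+1; have := small _ (leqW mm).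
  by rewrite /slope oddS odd_double /d gtr0_norm ?subr_gt0//=; move: _.+2%:R^-1 => e; lra.
Qed.

Lemma height_ge0 {R : realType} (x y : R) n :
  0 <= x <= 1 -> 0 <= y <= 1 -> 0 <= height x y n.
Proof.
move=> /(slope_itv _ n)/andP[x0 _] /(slope_itv _ n)/andP[y0 _].
by rewrite mulr_ge0// ?le_min ?x0// le_max lexx.
Qed.

Lemma height_le {R : realType} (x y : R) n :
  0 <= x <= 1 -> 0 <= y <= 1 -> height x y n <= slope n y.
Proof.
move=> /(slope_itv _ n)/andP[x0 _] /(slope_itv _ n)/andP[y0 _].
rewrite (@le_trans _ _ (Num.min (slope n x) (slope n y)))//.
  rewrite ler_piMr ?le_min ?x0// ge_max ler01/= gerBl mulr_ge0//.
by rewrite ge_min lexx orbT.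
Qed.

Lemma height_eq0 {R : realType} (x y : R) n :
  1 <= n%:R * `|x - y| -> height x y n = 0.
Proof. by move=> h; rewrite /height (max_idPl _) ?mulr0// subr_le0. Qed.

Lemma height_continuous {R : realType} (y : R) n :
  continuous (fun x => height x y n).
Proof.
move=> x.
have sc : {for x, continuous (@slope R n)}.
  apply: cvgM; last exact: cvg_cst.
  case: odd; first exact: cvg_id.
  by apply: cvgB; [exact: cvg_cst|exact: cvg_id].
apply: cvgM.
  by apply: (continuous_min sc); exact: cvg_cst.
apply: (@continuous_max R _ (cst 0) (fun x => 1 - n%:R * `|x - y|)).
  exact: cvg_cst.
apply: cvgB; first exact: cvg_cst.
apply: cvgM; first exact: cvg_cst.
apply: cvg_norm.
by apply: cvgB; [exact: cvg_id|exact: cvg_cst].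
Qed.

(** * The mapping on the unit square *)

Lemma unit_itvP {R : realType} (x : unit_itv R) : 0 <= (set_val x : R) <= 1.
Proof. by have := set_valP x; rewrite /= in_itv. Qed.

Lemma set_val_cvg {R : realType} (x : unit_itv R) :
  (set_val : unit_itv R -> R) @ x --> (set_val x : R).
Proof. exact: initial_continuous. Qed.

Lemma comb_height_continuous {R : realType} (y x0 : unit_itv R) :
  mv_continuous_at
    (fun x : unit_itv R => comb (height (set_val x : R) (set_val y))) x0.
Proof.
pose d : R := `|set_val x0 - set_val y|.
(* On the diagonal every tooth has its maximal length [slope n y], so no tooth outgrows it and the
   threshold is 0. *)
have [xy|xy] := eqVneq (set_val x0 : R) (set_val y).
  apply: (@comb_continuous R (unit_itv R) _ _ 0%N).
  - move=> n; exact: (cvg_comp _ _ (set_val_cvg x0) (height_continuous _ _ _)).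
  - by move=> x n; apply: height_ge0; exact: unit_itvP.
  - apply: (@nearW _ _ _ (nbhs_filter x0)) => x n _; rewrite xy heightxx.
    by apply: height_le; exact: unit_itvP.
have d0 : 0 < d by rewrite normr_gt0 subr_eq0.
(* Within [d / 2] of [x0] the distance to [y] is at least [d / 2], so the cutoff kills every tooth
   with [n >= 2 / d]. *)
apply: (@comb_continuous R (unit_itv R) _ _ (Num.truncn (2 / d)).+1).
- move=> n; exact: (cvg_comp _ _ (set_val_cvg x0) (height_continuous _ _ _)).
- by move=> x n; apply: height_ge0; exact: unit_itvP.
- have d20 : 0 < d / 2 by rewrite divr_gt0.
  have x0d : \forall x \near x0, `|set_val x0 - set_val x| < d / 2 :> R.
    exact: (@cvgr_dist_lt _ R^o _ _ (nbhs_filter x0) _ _ (set_val_cvg x0) _ d20).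
  apply: filterS x0d => x xd n nN.
  rewrite height_eq0; first by apply: height_ge0; exact: unit_itvP.
  have n2 : 2 / d <= n%:R.
    by rewrite (le_trans (ltW (truncnS_gt _)))// ler_nat.
  have : d / 2 <= `|set_val x - set_val y|.
    have := ler_distD (set_val x) (set_val x0) (set_val y : R).
    by rewrite -/d; lra.
  move=> /(ler_pM _ _ n2); rewrite mulrA divfK ?gt_eqF// divff//.
  by apply; rewrite divr_ge0// ltW.
Qed.

Lemma unit_itv_near {R : realType} (x0 : unit_itv R) (P : set (unit_itv R)) :
  (\forall x \near x0, P x) ->
  exists2 x : unit_itv R, P x & set_val x != set_val x0 :> R.
Proof.
move=> [_ [[B Bop <-] /= Bx0 BP]].
have /nbhs_ballP[e /= e0 eB] : nbhs (set_val x0 : R) B by exact: open_nbhs_nbhs.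
have := unit_itvP x0; set a : R := set_val x0 => /andP[a0 a1].
pose d : R := Num.min (e / 2) (1 / 2).
have de : d <= e / 2 by rewrite ge_min lexx.
have d1 : d <= 1 / 2 by rewrite ge_min lexx orbT.
have d0 : 0 < d by rewrite lt_min !divr_gt0.
(* Moving towards the farther endpoint by at most [1 / 2] stays in the unit interval. *)
pose b : R := if a <= 1 / 2 then a + d else a - d.
have [b01 abd] : 0 <= b <= 1 /\ `|a - b| = d.
  rewrite /b; case: (leP a (1 / 2)) => h; split; try lra.
    by rewrite opprD addNKr normrN gtr0_norm.
  by rewrite opprB addrC subrK gtr0_norm.
have bI : b \in (`[0, 1]%classic : set R) by rewrite inE /= in_itv.
exists (exist _ b bI : unit_itv R).
  by apply: BP => /=; apply: eB; rewrite set_valE /ball/= abd; lra.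
rewrite set_valE /=; apply/eqP => ba.
by move: abd; rewrite ba subrr normr0 => d00; rewrite -d00 ltxx in d0.
Qed.

Theorem corollary3p3 (R : realType) :
  exists f : unit_itv R * unit_itv R -> set R,
    [/\ closed_valued f,
        mv_separately_continuous f &
        forall x : unit_itv R, ~ mv_continuous_at (fun t => f (t, t)) x].
Proof.
exists (fun p => comb (height (set_val p.1 : R) (set_val p.2))); split.
- move=> [x y]; split; first exact: comb_neq0.
  by apply: comb_closed => n; apply: height_ge0; exact: unit_itvP.
- split=> [y x0|x y0] /=; first exact: comb_height_continuous.
  under eq_fun do rewrite heightC.
  exact: comb_height_continuous.
- move=> x0 [/comb_upper + _].
  have h01 (x : unit_itv R) n :
      0 <= height (set_val x : R) (set_val x) n <= 1 / 2.
    by rewrite heightxx slope_itv ?unit_itvP.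
  (* Upper continuity bounds all teeth at some [x] other than [x0] by those at [x0] plus the margin;
     [slope_gap] supplies an [n] violating this. *)
  move=> /(_ h01)/unit_itv_near[x hlt /slope_gap[n]].
  by rewrite leNgt; have := hlt n; rewrite /= !heightxx => ->.
Qed.
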